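(* Let $L\in\{\mathsf{NP},\mathsf{ND},\mathsf{NP4},\mathsf{ND4}\}$. Then for every modal formula $A$ the following are equivalent: (1) $L\vdash A$; (2) $A$ is valid in all $L$-frames; (3) $A$ is valid in all finite $L$-frames.
   Context: Let $\mathsf{MF}$ be the set of all modal propositional formulas. The pure logic of necessitation $\mathsf{N}$ is classical propositional logic (in the modal language) together with the necessitation rule: from $A$ infer $\Box A$. Define $\mathsf{NP}=\mathsf{N}+\neg\Box\bot$; $\mathsf{ND}=\mathsf{N}+\neg(\Box A\wedge\Box\neg A)$ (axiom scheme); $\mathsf{NP4}=\mathsf{NP}+(\Box A\to\Box\Box A)$; $\mathsf{ND4}=\mathsf{ND}+(\Box A\to\Box\Box A)$. An $\mathsf{N}$-frame is a tuple $(W,\{\prec_B\}_{B\in\mathsf{MF}})$ with $W$ non-empty and each $\prec_B$ a binary relation on $W$; it is finite if $W$ is finite. An $\mathsf{N}$-model adds a forcing relation $\Vdash$ satisfying the usual Boolean clauses and: $x\Vdash\Box B$ iff for all $y$, $x\prec_B y$ implies $y\Vdash B$. Validity in a model means forced at all worlds; validity in a frame means validity in all models on that frame. An $\mathsf{N}$-frame is an $\mathsf{NP}$-frame if every $x$ has some $y$ with $x\prec_\bot y$; an $\mathsf{ND}$-frame if for every $A\in\mathsf{MF}$ and $x\in W$ there is $y$ with $x\prec_A y$ and $x\prec_{\neg A} y$. It is transitive if for all $A\in\mathsf{MF}$ and $x,y,z\in W$, $x\prec_{\Box A}y$ and $y\prec_A z$ imply $x\prec_A z$. An $\mathsf{NP4}$-frame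 is a transitive $\mathsf{NP}$-frame, and an $\mathsf{ND4}$-frame is a transitive $\mathsf{ND}$-frame. ''$L$-frame'' refers to the corresponding class. *)

(* Defs.v *)
From Stdlib Require Import Bool FinFun.

Set Implicit Arguments.
Unset Strict Implicit.

Inductive formula : Type :=
| Var : nat -> formula
| Bot : formula
| Neg : formula -> formula
| And : formula -> formula -> formula
| Or : formula -> formula -> formula
| Imp : formula -> formula -> formula
| Box : formula -> formula.

(* Truth value of a modal formula in which boxed formulas are treated as
   propositional atoms: [v] evaluates the variables, [b] evaluates [Box A] as
   [b A]. *)
Fixpoint truth_value (v : nat -> bool) (b : formula -> bool) (A : formula)
  : bool :=
  match A with
  | Var n => v n
  | Bot => false
  | Neg B => negb (truth_value v b B)
  | And B C => truth_value v b B && truth_value v b C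
  | Or B C => truth_value v b B || truth_value v b C
  | Imp B C => implb (truth_value v b B) (truth_value v b C)
  | Box B => b B
  end.

Definition tautology (A : formula) : Prop :=
  forall (v : nat -> bool) (b : formula -> bool), truth_value v b A = true.

(* [N_plus Ax] is N + Ax: the least set of formulas that contains the
   tautologies in the modal language and the axioms [Ax], and is closed under
   modus ponens and necessitation. *)
Inductive N_plus (Ax : formula -> Prop) : formula -> Prop :=
| N_taut (A : formula) : tautology A -> N_plus Ax A
| N_axiom (A : formula) : Ax A -> N_plus Ax A
| N_mp (A B : formula) : N_plus Ax (Imp A B) -> N_plus Ax A -> N_plus Ax B
| N_nec (A : formula) : N_plus Ax A -> N_plus Ax (Box A).

Inductive axiom_P : formula -> Prop :=
| AxP : axiom_P (Neg (Box Bot)).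

Inductive axiom_D : formula -> Prop :=
| AxD (A : formula) : axiom_D (Neg (And (Box A) (Box (Neg A)))).

Inductive axiom_4 : formula -> Prop :=
| Ax4 (A : formula) : axiom_4 (Imp (Box A) (Box (Box A))).

Inductive logic : Type := NP | ND | NP4 | ND4.

Definition logic_axiom (L : logic) (A : formula) : Prop :=
  match L with
  | NP => axiom_P A
  | ND => axiom_D A
  | NP4 => axiom_P A \/ axiom_4 A
  | ND4 => axiom_D A \/ axiom_4 A
  end.

Definition provable (L : logic) (A : formula) : Prop :=
  N_plus (logic_axiom L) A.

Record frame : Type := Frame {
  world :> Type;
  world_inhabited : inhabited world;
  acc : formula -> world -> world -> Prop
}.

Record model (F : frame) : Type := Model {
  forces : F -> formula -> Prop;
  forces_bot : forall x, ~ forces x Bot;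
  forces_neg : forall x A, forces x (Neg A) <-> ~ forces x A;
  forces_and : forall x A B,
    forces x (And A B) <-> forces x A /\ forces x B;
  forces_or : forall x A B,
    forces x (Or A B) <-> forces x A \/ forces x B;
  forces_imp : forall x A B,
    forces x (Imp A B) <-> (forces x A -> forces x B);
  forces_box : forall x B,
    forces x (Box B) <-> forall y, acc B x y -> forces y B
}.

Definition valid_in_model (F : frame) (M : model F) (A : formula) : Prop :=
  forall x : F, forces M x A.

Definition valid_in_frame (F : frame) (A : formula) : Prop :=
  forall M : model F, valid_in_model M A.

Definition finite_frame (F : frame) : Prop := Finite F.

Definition NP_frame (F : frame) : Prop :=
  forall x : F, exists y : F, acc Bot x y.

Definition ND_frame (F : frame) : Prop :=
  forall (A : formula) (x : F), exists y : F, acc A x y /\ acc (Neg A) x y.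

Definition transitive_frame (F : frame) : Prop :=
  forall (A : formula) (x y z : F), acc (Box A) x y -> acc A y z -> acc A x z.

Definition logic_frame (L : logic) (F : frame) : Prop :=
  match L with
  | NP => NP_frame F
  | ND => ND_frame F
  | NP4 => transitive_frame F /\ NP_frame F
  | ND4 => transitive_frame F /\ ND_frame F
  end.

(* Main.v *)
(** Completeness with finite models.  For an unprovable formula [A], take a
    finite list [At] of propositional atoms (variables and boxed formulas)
    closed under the atoms inside boxed formulas, and take as worlds the truth
    assignments [s] to [At] under which every theorem over [At] is true.  Extend
    [s] to all boxed formulas by letting [Box B] inherit the value of [B] when
    [B] is itself boxed and [Box B] lies outside [At], and be false otherwise.
    Put [acc B x y] iff [Box B] is false at [x] or [B] is true at [y]; necessitation
    yields the truth lemma.  The extension is chosen so that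
    [Box B -> Box (Box B)] passes from [At] to all [B], which makes the frame
    transitive when axiom 4 is provable.  For the axiom D, [At] is moreover
    closed under [Box (Neg B) |-> Box B]. *)

Require Import Defs.
From Stdlib Require Import Bool List FinFun Classical ClassicalEpsilon.
Import ListNotations.

Set Implicit Arguments.
Unset Strict Implicit.

(** * Membership, sublists and finite subtypes *)

Lemma formula_eq_dec (A B : formula) : {A = B} + {A <> B}.
Proof. repeat decide equality. Defined.

Definition mem (A : formula) (l : list formula) : bool :=
  if in_dec formula_eq_dec A l then true else false.

Lemma mem_In (A : formula) (l : list formula) : mem A l = true <-> In A l.
Proof.
unfold mem; destruct (in_dec formula_eq_dec A l); split; easy.
Qed.

Fixpoint sublists (l : list formula) : list (list formula) :=
  match l with
  | [] => [[]]
  | a :: l' => sublists l' ++ map (cons a) (sublists l')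
  end.

Lemma filter_in_sublists (f : formula -> bool) (l : list formula) :
  In (filter f l) (sublists l).
Proof.
induction l as [|a l IH]; simpl; [now left|].
apply in_or_app; destruct (f a); [right; now apply in_map | now left].
Qed.

Lemma finite_sig (T : Type) (P : T -> Prop) (l : list T) :
  (forall x, P x -> In x l) -> Finite {x : T | P x}.
Proof.
intros Pl.
assert (H : exists l' : list {x : T | P x},
  forall y, In (proj1_sig y) l -> In y l').
{ clear Pl; induction l as [|a l [l' IH]].
  - now exists [].
  - destruct (classic (P a)) as [Pa|nPa].
    + exists (exist _ a Pa :: l'); intros [x Px]; simpl; intros [e|i].
      * left; subst x; f_equal; apply proof_irrelevance.
      * right; now apply IH.
    + exists l'; intros [x Px]; simpl; intros [e|i].
      * now subst x.
      * now apply IH. }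
destruct H as [l' H]; exists l'; intros y; apply H, Pl, (proj2_sig y).
Qed.

(** * Soundness *)

Lemma forces_tautology (F : frame) (M : model F) (x : F) (A : formula) :
  tautology A -> forces M x A.
Proof.
intros tA.
(* Forcing at [x] becomes a Boolean assignment in which boxed formulas are atoms. *)
pose (d := fun B => if excluded_middle_informative (forces M x B)
                    then true else false).
assert (dE : forall B, d B = true <-> forces M x B).
{ intros B; unfold d; now destruct excluded_middle_informative. }
enough (H : forall B,
  truth_value (fun n => d (Var n)) (fun C => d (Box C)) B = true
  <-> forces M x B) by apply H, tA.
induction B as [n| |B IH|B IHB C IHC|B IHB C IHC|B IHB C IHC|B _]; simpl.
- apply dE.
- split; [easy | intros H; now apply forces_bot in H].
- rewrite forces_neg, <- IH, negb_true_iff, not_true_iff_false; easy.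
- rewrite forces_and, andb_true_iff; tauto.
- rewrite forces_or, orb_true_iff; tauto.
- rewrite forces_imp, implb_true_iff; tauto.
- apply dE.
Qed.

Lemma forces_axiom_P (F : frame) (M : model F) (x : F) (A : formula) :
  NP_frame F -> axiom_P A -> forces M x A.
Proof.
intros hF [].
rewrite forces_neg, forces_box; intros H.
destruct (hF x) as [y xy]; now apply (forces_bot (m := M) (x := y)), H.
Qed.

Lemma forces_axiom_D (F : frame) (M : model F) (x : F) (A : formula) :
  ND_frame F -> axiom_D A -> forces M x A.
Proof.
intros hF [B].
rewrite forces_neg, forces_and, !forces_box; intros [H1 H2].
destruct (hF B x) as [y [xy1 xy2]].
apply H2 in xy2; rewrite forces_neg in xy2; now apply xy2, H1.
Qed.

Lemma forces_axiom_4 (F : frame) (M : model F) (x : F) (A : formula) :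
  transitive_frame F -> axiom_4 A -> forces M x A.
Proof.
intros hF [B].
rewrite forces_imp, !forces_box; intros H y xy.
rewrite forces_box; intros z yz; apply H, (hF B x y z xy yz).
Qed.

Lemma soundness (L : logic) (A : formula) :
  provable L A -> forall F : frame, logic_frame L F -> valid_in_frame F A.
Proof.
intros pA F hF M.
induction pA as [A tA|A aA|A B _ IHAB _ IHA|A _ IHA]; intros x.
- now apply forces_tautology.
- destruct L; simpl in hF, aA.
  + now apply forces_axiom_P.
  + now apply forces_axiom_D.
  + destruct hF, aA; [now apply forces_axiom_P | now apply forces_axiom_4].
  + destruct hF, aA; [now apply forces_axiom_D | now apply forces_axiom_4].
- specialize (IHAB x); rewrite forces_imp in IHAB; apply IHAB, IHA.
- rewrite forces_box; intros y _; apply IHA.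
Qed.

(** * Truth assignments to finitely many atoms *)

(** A boxed formula is itself an atom, so the formula under the box is not inspected. *)
Fixpoint over (At : list formula) (A : formula) : Prop :=
  match A with
  | Var n => In (Var n) At
  | Bot => True
  | Neg B => over At B
  | And B C | Or B C | Imp B C => over At B /\ over At C
  | Box B => In (Box B) At
  end.

(** The list [s] holds the true atoms. Outer boxes are stripped until an element of [At] appears; if
    none does, the value is false. *)
Fixpoint box_value (At s : list formula) (B : formula) : bool :=
  if in_dec formula_eq_dec (Box B) At then mem (Box B) s
  else match B with Box C => box_value At s C | _ => false end.

Definition value (At s : list formula) (A : formula) : bool :=
  truth_value (fun n => mem (Var n) s) (box_value At s) A.

Lemma box_value_in (At s : list formula) (B : formula) :
  In (Box B) At -> box_value At s B = mem (Box B) s.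
Proof.
intros i; destruct B; cbn [box_value];
  destruct in_dec as [j|nj]; easy.
Qed.

Lemma box_value_notin (At s : list formula) (B : formula) :
  ~ In (Box B) At ->
  box_value At s B = match B with Box C => box_value At s C | _ => false end.
Proof.
intros ni; destruct B; cbn [box_value];
  destruct in_dec as [j|nj]; easy.
Qed.

(** Sublists of [At] thus represent all assignments, so tautologies over [At] can be checked on
    finitely many lists. *)
Lemma value_filter (At : list formula) (v : nat -> bool) (b : formula -> bool)
    (A : formula) :
  over At A -> value At (filter (truth_value v b) At) A = truth_value v b A.
Proof.
assert (memE : forall B, In B At ->
  mem B (filter (truth_value v b) At) = truth_value v b B).
{ intros B i; apply eq_true_iff_eq; rewrite mem_In, filter_In; tauto. }
unfold value; induction A as [n| |B IH|B IHB C IHC|B IHB C IHC|B IHB C IHC|B _];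
  cbn [over truth_value]; intros o.
- now apply memE.
- easy.
- now rewrite IH.
- now rewrite IHB, IHC.
- now rewrite IHB, IHC.
- now rewrite IHB, IHC.
- rewrite box_value_in by easy; now apply memE.
Qed.

Definition is_world (L : logic) (At s : list formula) : Prop :=
  In s (sublists At) /\
  forall T, provable L T -> over At T -> value At s T = true.

Lemma provable_and (L : logic) (A B : formula) :
  provable L A -> provable L B -> provable L (And A B).
Proof.
intros pA pB; refine (N_mp (N_mp (N_taut _ _) pA) pB).
intros v b; simpl; now destruct (truth_value v b A), (truth_value v b B).
Qed.

(** Conjoin one refuting theorem for each of the finitely many assignments in [l] that falsify
    [A]. *)
Lemma separating_theorem (L : logic) (At : list formula) (A : formula)
    (l : list (list formula)) :
  (forall s, In s l -> value At s A = false ->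
    exists T, provable L T /\ over At T /\ value At s T = false) ->
  exists T, provable L T /\ over At T /\
    forall s, In s l -> value At s T = true -> value At s A = true.
Proof.
induction l as [|s l IH]; intros H.
- exists (Imp Bot Bot); repeat split; [now apply N_taut | easy].
- destruct IH as [T [pT [oT hT]]].
  { intros t i; apply H; now right. }
  destruct (value At s A) eqn:e.
  + exists T; repeat split; auto.
    intros t [<-|i]; auto.
  + destruct (H s (or_introl eq_refl) e) as [U [pU [oU hU]]].
    exists (And T U); repeat split; auto using provable_and.
    intros t i; unfold value in *; simpl; rewrite andb_true_iff.
    intros [tT tU]; destruct i as [<-|i]; [congruence | auto].
Qed.

(** If no world falsified [A], a single theorem [T] would fail under every assignment falsifying
    [A]; then [Imp T A] would be a tautology and [A] provable. *)
Lemma exists_world (L : logic) (At : list formula) (A : formula) :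
  over At A -> ~ provable L A ->
  exists s, is_world L At s /\ value At s A = false.
Proof.
intros oA npA; apply NNPP; intros none; apply npA.
destruct (@separating_theorem L At A (sublists At)) as [T [pT [oT hT]]].
{ intros s i e; apply NNPP; intros noT; apply none.
  exists s; repeat split; auto.
  intros T pT oT; apply not_false_iff_true; intros eT; apply noT; eauto. }
refine (N_mp (N_taut _ _) pT).
intros v b; simpl; rewrite implb_true_iff.
rewrite <- (@value_filter At v b T), <- (@value_filter At v b A) by easy.
apply hT, filter_in_sublists.
Qed.

Lemma exists_world_true (L : logic) (At : list formula) (A : formula) :
  over At A -> ~ provable L (Neg A) ->
  exists s, is_world L At s /\ value At s A = true.
Proof.
intros oA np; destruct (@exists_world L At (Neg A) oA np) as [s [ws e]].
exists s; split; [easy | now apply negb_false_iff].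
Qed.

(** * The canonical finite model *)

Definition canonical_world (L : logic) (At : list formula) : Type :=
  {s : list formula | is_world L At s}.

Definition canonical_frame (L : logic) (At : list formula)
    (w : inhabited (canonical_world L At)) : frame :=
  @Frame (canonical_world L At) w (fun B x y =>
    box_value At (proj1_sig x) B = true -> value At (proj1_sig y) B = true).

Lemma canonical_finite (L : logic) (At : list formula)
    (w : inhabited (canonical_world L At)) :
  finite_frame (canonical_frame w).
Proof. apply finite_sig with (l := sublists At); now intros s []. Qed.

Fixpoint sat (F : frame) (V : F -> nat -> Prop) (x : F) (A : formula) : Prop :=
  match A with
  | Var n => V x n
  | Bot => False
  | Neg B => ~ sat V x B
  | And B C => sat V x B /\ sat V x C
  | Or B C => sat V x B \/ sat V x C
  | Imp B C => sat V x B -> sat V x C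
  | Box B => forall y, acc B x y -> sat V y B
  end.

Definition model_of (F : frame) (V : F -> nat -> Prop) : model F.
Proof. refine (@Model F (sat V) _ _ _ _ _ _); simpl; tauto. Defined.

Definition closed (At : list formula) : Prop :=
  (forall B, In (Box B) At -> over At B) /\
  (forall B, In (Box (Neg B)) At -> In (Box B) At).

Lemma truth_lemma (L : logic) (At : list formula)
    (w : inhabited (canonical_world L At)) (B : formula) :
  closed At -> over At B -> forall x : canonical_frame w,
  sat (fun (y : canonical_frame w) n => mem (Var n) (proj1_sig y) = true) x B
  <-> value At (proj1_sig x) B = true.
Proof.
intros [cl _].
induction B as [n| |B IH|B IHB C IHC|B IHB C IHC|B IHB C IHC|B IH];
  unfold value in *; cbn [over sat truth_value]; intros o x.
- easy.
- easy.
- rewrite (IH o), negb_true_iff, not_true_iff_false; easy.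
- destruct o; rewrite IHB, IHC, andb_true_iff by easy; tauto.
- destruct o; rewrite IHB, IHC, orb_true_iff by easy; tauto.
- destruct o; rewrite IHB, IHC, implb_true_iff by easy; tauto.
- assert (oB := cl B o); split.
  (* If [Box B] is false at [x], then every world is a [B]-successor of [x]. So [B] holds at all
     worlds and is provable, and necessitation makes [Box B] true at [x]. *)
  + intros H; apply not_false_iff_true; intros e.
    assert (pB : provable L B).
    { apply NNPP; intros npB.
      destruct (@exists_world L At B oB npB) as [s [ws es]].
      assert (Hs := H (exist _ s ws)); rewrite IH in Hs by easy.
      unfold value in es; simpl in Hs; rewrite e in Hs.
      now rewrite Hs in es. }
    destruct (proj2_sig x) as [_ tx].
    specialize (tx (Box B) (N_nec pB) o); unfold value in tx; simpl in tx.
    congruence.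
  + intros e y xy; apply IH; auto.
Qed.

Lemma canonical_NP (L : logic) (At : list formula)
    (w : inhabited (canonical_world L At)) :
  provable L (Neg (Box Bot)) -> NP_frame (canonical_frame w).
Proof.
intros pP x; exists x; cbn [acc canonical_frame]; intros e; exfalso.
destruct (in_dec formula_eq_dec (Box Bot) At) as [i|ni].
- destruct (proj2_sig x) as [_ tx].
  specialize (tx _ pP i); unfold value in tx; cbn [truth_value] in tx.
  now rewrite e in tx.
- now rewrite (box_value_notin _ ni) in e.
Qed.

(** The successor must satisfy [B] if [Box B] is true at [x], and falsify [B] if [Box (Neg B)] is. D
    and the default value exclude both at once; a world meeting the one remaining demand exists
    because the opposite formula is unprovable. *)
Lemma canonical_ND (L : logic) (At : list formula)
    (w : inhabited (canonical_world L At)) :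
  closed At ->
  (forall B, provable L (Neg (And (Box B) (Box (Neg B))))) ->
  ND_frame (canonical_frame w).
Proof.
intros [cl clN] pD B x; cbn [acc canonical_frame].
assert (notboth : In (Box (Neg B)) At -> box_value At (proj1_sig x) B = true ->
                  box_value At (proj1_sig x) (Neg B) = true -> False).
{ intros i e1 e2; destruct (proj2_sig x) as [_ tx].
  specialize (tx _ (pD B) (conj (clN _ i) i)).
  unfold value in tx; cbn [truth_value] in tx; now rewrite e1, e2 in tx. }
assert (thm : forall C, In (Box C) At -> provable L C ->
                box_value At (proj1_sig x) C = true).
{ intros C i pC; destruct (proj2_sig x) as [_ tx]; exact (tx _ (N_nec pC) i). }
destruct (box_value At (proj1_sig x) (Neg B)) eqn:eN.
- destruct (in_dec formula_eq_dec (Box (Neg B)) At) as [i|ni];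
    [|now rewrite (box_value_notin _ ni) in eN].
  destruct (@exists_world L At B (cl _ (clN _ i))) as [s [ws es]].
  { intros pB; apply notboth; auto. }
  exists (exist _ s ws); split.
  + intros e; exfalso; auto.
  + intros _; unfold value in *; simpl; now rewrite es.
- destruct (in_dec formula_eq_dec (Box B) At) as [i|ni].
  + destruct (box_value At (proj1_sig x) B) eqn:eB.
    * destruct (@exists_world_true L At B (cl _ i)) as [s [ws es]].
      { intros pNB.
        (* [Box (Neg B)] need not lie in [At], so D is first used to refute
           [Box B] inside the logic. *)
        assert (pNBB : provable L (Neg (Box B))).
        { refine (N_mp (N_mp (N_taut _ _) (pD B)) (N_nec pNB)).
          intros v b; simpl; now destruct (b B), (b (Neg B)). }
        destruct (proj2_sig x) as [_ tx]; specialize (tx _ pNBB i).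
        unfold value in tx; cbn [truth_value] in tx; now rewrite eB in tx. }
      exists (exist _ s ws); now split.
    * now exists x.
  (* Outside [At], [Box B] is false unless [B] is boxed, and then it has the value of [B] at [x]; so
     [x] itself serves. *)
  + exists x; split; [|easy].
    rewrite (box_value_notin _ ni); now destruct B.
Qed.

Lemma canonical_transitive (L : logic) (At : list formula)
    (w : inhabited (canonical_world L At)) :
  closed At -> (forall B, provable L (Imp (Box B) (Box (Box B)))) ->
  transitive_frame (canonical_frame w).
Proof.
intros [cl _] p4 B x y z; cbn [acc canonical_frame]; intros xy yz e.
(* It remains to pass from [Box B] to [Box (Box B)] at [x]: by axiom 4 inside [At], by inheritance
   outside. *)
apply yz, xy.
destruct (in_dec formula_eq_dec (Box (Box B)) At) as [i|ni].
- destruct (proj2_sig x) as [_ tx].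
  specialize (tx _ (p4 B) (conj (cl _ i) i)).
  unfold value in tx; cbn [truth_value] in tx; now rewrite e in tx.
- now rewrite (box_value_notin _ ni).
Qed.

Lemma canonical_logic_frame (L : logic) (At : list formula)
    (w : inhabited (canonical_world L At)) :
  closed At -> logic_frame L (canonical_frame w).
Proof.
intros cl; destruct L; simpl; repeat split.
- apply canonical_NP, N_axiom; constructor.
- apply canonical_ND; [easy|]; intros B; apply N_axiom; constructor.
- apply canonical_transitive; [easy|]; intros B; apply N_axiom; right; constructor.
- apply canonical_NP, N_axiom; left; constructor.
- apply canonical_transitive; [easy|]; intros B; apply N_axiom; right; constructor.
- apply canonical_ND; [easy|]; intros B; apply N_axiom; left; constructor.
Qed.

(** * Closed sets of atoms *)

(** Stripping leading negations under the box one by one provides the closure needed for D. *)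
Fixpoint box_chain (B : formula) : list formula :=
  Box B :: match B with Neg C => box_chain C | _ => [] end.

Fixpoint atoms (A : formula) : list formula :=
  match A with
  | Var n => [Var n]
  | Bot => []
  | Neg B => atoms B
  | And B C | Or B C | Imp B C => atoms B ++ atoms C
  | Box B => box_chain B ++ atoms B
  end.

Lemma over_incl (At At' : list formula) (A : formula) :
  incl At At' -> over At A -> over At' A.
Proof. intros H; induction A; simpl; firstorder. Qed.

Lemma box_chain_head (B : formula) : In (Box B) (box_chain B).
Proof. destruct B; now left. Qed.

Lemma over_atoms (A : formula) : over (atoms A) A.
Proof.
induction A; simpl; auto; try split;
  try (eapply over_incl; [|eassumption]; auto using incl_appl, incl_appr, incl_refl).
apply in_or_app; left; apply box_chain_head.
Qed.

(** Here [B] is [C] without some leading negations, which contribute no atoms. *)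
Lemma box_chain_over (At : list formula) (B C : formula) :
  over At C -> In (Box B) (box_chain C) -> over At B.
Proof.
induction C; simpl; intros o [e|i]; try easy; try (injection e as <-; easy).
auto.
Qed.

Lemma box_chain_neg (B C : formula) :
  In (Box (Neg B)) (box_chain C) -> In (Box B) (box_chain C).
Proof.
induction C; simpl; intros [e|i]; try easy; right.
- injection e as <-; apply box_chain_head.
- auto.
Qed.

Lemma closed_app (At At' : list formula) :
  closed At -> closed At' -> closed (At ++ At').
Proof.
intros [o1 n1] [o2 n2]; split; intros B i;
  apply in_app_or in i; destruct i as [i|i].
- eapply over_incl; [apply incl_appl, incl_refl | auto].
- eapply over_incl; [apply incl_appr, incl_refl | auto].
- apply in_or_app; auto.
- apply in_or_app; auto.
Qed.

Lemma closed_atoms (A : formula) : closed (atoms A).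
Proof.
induction A as [n| |B IH|B IHB C IHC|B IHB C IHC|B IHB C IHC|B [IHo IHn]]; simpl;
  auto using closed_app.
- split; intros B [e|[]]; easy.
- now split.
- split; intros C i; apply in_app_or in i; destruct i as [i|i].
  + eapply over_incl; [apply incl_appr, incl_refl|].
    apply (box_chain_over (C := B)); auto using over_atoms.
  + eapply over_incl; [apply incl_appr, incl_refl | auto].
  + apply in_or_app; left; now apply box_chain_neg.
  + apply in_or_app; auto.
Qed.

Lemma finite_completeness (L : logic) (A : formula) :
  (forall F : frame, finite_frame F -> logic_frame L F -> valid_in_frame F A) ->
  provable L A.
Proof.
intros H; apply NNPP; intros npA.
destruct (exists_world (over_atoms A) npA) as [s [ws es]].
pose (x := exist _ s ws : canonical_world L (atoms A)).
(* The world refuting [A] also shows that the frame is non-empty. *)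
pose (w := inhabits x).
assert (hA := H (canonical_frame w) (canonical_finite w)
  (canonical_logic_frame w (closed_atoms A))
  (model_of (fun (y : canonical_frame w) n => mem (Var n) (proj1_sig y) = true)) x).
apply (truth_lemma (closed_atoms A) (over_atoms A)) in hA.
simpl in hA; congruence.
Qed.

Theorem theorem3p10 (L : logic) (A : formula) :
  (provable L A <-> (forall F : frame, logic_frame L F -> valid_in_frame F A)) /\
  ((forall F : frame, logic_frame L F -> valid_in_frame F A) <->
   (forall F : frame, finite_frame F -> logic_frame L F -> valid_in_frame F A)).
Proof.
repeat split.
- apply soundness.
- intros H; apply finite_completeness; auto.
- auto.
- intros H; now apply soundness, finite_completeness.
Qed.
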